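(* In the Ising mixed $p$-spin model with parameters $(\xi,h)$, $\xi$ convex on $[-1,1]$: FEB implies Generalized FEB.
   Context: **Model.** For $N\ge1$ let $\Sigma_N=\{-1,1\}^N$ and let $d\sigma$ be the uniform probability measure on $\Sigma_N$. Let $\xi(t)=\sum_{p\ge1}\beta_p^2t^p$ with $\xi(1+\epsilon)<\infty$ for some $\epsilon>0$, and $h\ge0$. $H_N$ is the Gaussian process on $\Sigma_N$ with $\mathbb{E}H_N(\sigma)=h\sum_i\sigma_i$ and $\mathrm{Cov}(H_N(\sigma^1),H_N(\sigma^2))=N\xi(R_{12})$, where $R_{12}=\frac1N\sum_i\sigma^1_i\sigma^2_i$. The Gibbs measure is $\pi_N(d\sigma)=e^{-H_N(\sigma)}d\sigma/Z_N$. **FEB.** FEB holds if for some $C>0$ there exist $-1\le q_1<q_2<q_3\le1$ and $0<\epsilon<\frac14\min\{q_3-q_2,q_2-q_1\}$ such that $\limsup_N\frac1N\log\mathbb{P}(\pi_N^{\otimes2}(R_{12}\in(q_2-\epsilon,q_2+\epsilon))>e^{-CN})<0$ and $\liminf_N\mathbb{E}\pi_N^{\otimes2}(R_{12}\in(q_i-\epsilon,q_i+\epsilon))>0$ for $i=1,3$. **Generalized FEB.** Let $\mathcal H=\sup_{-1\le q_1<q_2<q_3\le1}\big(-I(q_1)+I(q_2)-I(q_3)\big)$. Generalized FEB holds if $\mathcal H>0$. Here $I:[-1,1]\to[0,\infty]$ is the rate function of the almost sure large deviation principle with speed $N$ for $\mathscr Q_N(\cdot)=\pi_N^{\otimes2}(R_{12}\in\cdot)$,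 given by $$I(q)=-\inf_{\lambda\in\mathbb R,\ Q\in\mathcal Q_q,\ \nu\in\Pr([0,1])}P(\nu,Q,\lambda)+2\min_{\nu\in\Pr([0,1])}P_I(\nu).$$ **Functional $P_I$.** For $\nu\in\Pr([0,1])$ let $\phi_\nu:[0,1]\times\mathbb R\to\mathbb R$ be the unique weak solution (continuous, with essentially bounded weak spatial derivative, equation in the distributional sense) of $\partial_t\phi_\nu+\frac{\xi''(t)}2(\partial_x^2\phi_\nu+\nu([0,t])(\partial_x\phi_\nu)^2)=0$, $\phi_\nu(1,x)=\log\cosh x$; then $P_I(\nu)=\phi_\nu(0,h)-\frac12\int_0^1\xi''(s)s\,\nu([0,s])ds$. **Functional $P$.** For $q\in[-1,1]$, $\mathcal Q_q$ is the set of continuous, weakly differentiable ($W^{1,1}$), non-decreasing (in the positive semidefinite order) paths $Q_t=(q_{ij}(t))_{i,j\le 2}$, $t\in[0,1]$, of $2\times2$ positive semidefinite matrices with $Q_0=0$ and $Q_1=\begin{pmatrix}1 & q \\ q & 1\end{pmatrix}$. Put $A(t)=\xi''(Q_t)\odot\dot Q_t$ ($\odot$ is the entrywise product, $\xi''$ applied entrywise). For $\lambda\in\mathbb R$ let $u$ be the weak solution on $[0,1]\times\mathbb R^2$ of $$\partial_tu+\tfrac12\big(\langle A,D^2u\rangle+\nu([0,t])\langle Du,A\,Du\rangle\big)=0,\qquad u(1,x)=\log\Big(\tfrac14\sum_{\epsilon_1,\epsilon_2\in\{\pm1\}}e^{\epsilon_1x_1+\epsilon_2x_2+\lambda\epsilon_1\epsilon_2}\Big)$$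 (for degenerate $A$, $u$ is understood by continuous extension, i.e. as the limit $\delta\downarrow0$ of the solutions with $A+\delta\,\mathrm{Id}$). Then $$P(\nu,Q,\lambda)=u(0,(h,h))-\lambda q-\tfrac12\sum_{i,j}\int_0^1\nu([0,t])\,\xi''(q_{ij}(t))\,q_{ij}(t)\,\dot q_{ij}(t)\,dt .$$ *)

(* Defs.v *)
From HB Require Import structures.
From mathcomp Require Import all_boot all_order all_algebra.
From mathcomp Require Import all_classical all_reals all_analysis.

Set Implicit Arguments.
Unset Strict Implicit.
Unset Printing Implicit Defensive.

Import Order.TTheory GRing.Theory Num.Theory.
Import numFieldNormedType.Exports.

Local Open Scope classical_set_scope.
Local Open Scope ring_scope.

Section Model.
Context {R : realType}.

Definition xi_psum (beta : R^nat) (t : R) : R^nat :=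
  fun n => \sum_(1 <= p < n) beta p ^+ 2 * t ^+ p.

Definition xi (beta : R^nat) (t : R) : R := limn (xi_psum beta t).

Definition xi2 (beta : R^nat) : R -> R := derive1n 2 (xi beta).

(* A configuration in {-1,1}^N is encoded by its signs: true stands for -1. *)
Definition config (N : nat) : finType := {ffun 'I_N -> bool}.

Definition spin N (s : config N) (i : 'I_N) : R := (-1) ^+ (s i).

Definition overlap N (s t : config N) : R :=
  N%:R^-1 * \sum_(i < N) spin s i * spin t i.

Definition partition_function N (E : config N -> R) : R :=
  \sum_(s : config N) (2 ^+ N)^-1 * expR (- E s).

Definition gibbs N (E : config N -> R) (s : config N) : R :=
  (2 ^+ N)^-1 * expR (- E s) / partition_function E.

Definition overlap_law N (E : config N -> R) (A : set R) : R :=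
  \sum_(s : config N) \sum_(t : config N)
    gibbs E s * gibbs E t * \1_A (overlap s t).

End Model.

Section Hamiltonian.
Context {R : realType} d (T : measurableType d) (P : probability T R).

(* Variance 0 is a Dirac mass and has to be singled out: the convention of
   normal_prob for s = 0 is a different one. *)
Definition gaussian (X : T -> R) : Prop :=
  exists m s : R, 0 <= s /\
    forall A : set (measurableTypeR R), measurable A ->
      P (X @^-1` A) = if s == 0 then \d_m A else normal_prob m s A.

Definition gaussian_process (J : finType) (X : J -> {RV P >-> R}) : Prop :=
  forall a : J -> R, gaussian (fun w => \sum_(j : J) a j * X j w).

Definition ising_mixed_p_spin (beta : R^nat) (h : R)
    (H : forall N, config N -> {RV P >-> R}) : Prop :=
  forall N, (0 < N)%N ->
    [/\ gaussian_process (H N),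
        forall s : config N,
          ('E_P[H N s] = (h * \sum_(i < N) spin s i)%:E)%E &
        forall s t : config N,
          covariance P (H N s) (H N t) = (N%:R * xi beta (overlap s t))%:E].

(* The random measure pi_N^{\otimes 2}(R_12 \in .) *)
Definition random_overlap_law (H : forall N, config N -> {RV P >-> R})
    (w : T) (N : nat) (A : set R) : R :=
  overlap_law (fun s => H N s w) A.

Definition near_itv (q e : R) : set R := `](q - e), (q + e)[%classic.

Definition FEB (H : forall N, config N -> {RV P >-> R}) : Prop :=
  exists C q1 q2 q3 e : R,
    [/\ 0 < C,
        [/\ -1 <= q1, q1 < q2, q2 < q3 & q3 <= 1],
        0 < e < 4^-1 * Num.min (q3 - q2) (q2 - q1),
        (limn_esup (fun N => N%:R^-1%:E * lne (P [set w |
           expR (- (C * N%:R)) < random_overlap_law H w N (near_itv q2 e)]%R))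
           < 0)%E &
        forall q, q = q1 \/ q = q3 ->
        (0 < limn_einf (fun N =>
           'E_P[fun w => random_overlap_law H w N (near_itv q e)]))%E].

End Hamiltonian.

Section LargeDeviations.
Context {R : realType}.
Local Open Scope ereal_scope.

(* Large deviation principle on [-1, 1] with speed N for measures Q N carried
   by [-1, 1].  Subsets of [-1, 1] that are relatively open (resp. closed) are
   traces of open (resp. closed) subsets of R. *)
Definition large_deviation_principle
    (Q : nat -> set R -> R) (I : R -> \bar R) : Prop :=
  [/\ forall q : R, (-1 <= q <= 1)%R -> 0 <= I q,
      forall a : R, closed [set q : R | (-1 <= q <= 1)%R /\ I q <= a%:E],
      forall F : set R, closed F ->
        limn_esup (fun N => N%:R^-1%:E * lne (Q N F)%:E) <=
          - ereal_inf (I @` (F `&` `[(-1)%R, 1%R]%classic)) &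
      forall G : set R, open G ->
        - ereal_inf (I @` (G `&` `[(-1)%R, 1%R]%classic)) <=
          limn_einf (fun N => N%:R^-1%:E * lne (Q N G)%:E)].

(* For I >= 0, the MathComp convention (+oo) + (-oo) = -oo discards the triples
   for which the alternating sum is indeterminate. *)
Definition barrier_height (I : R -> \bar R) : \bar R :=
  ereal_sup [set x | exists q1 q2 q3 : R,
    [/\ (-1 <= q1)%R, (q1 < q2)%R, (q2 < q3)%R, (q3 <= 1)%R &
        x = - I q1 + I q2 - I q3]].

Definition generalized_FEB (I : R -> \bar R) : Prop := 0 < barrier_height I.

End LargeDeviations.

Section WeakSolutions.
Context {R : realType}.

Definition iter_derive (V : normedModType R) (f : V -> R) (vs : seq V) : V -> R :=
  foldr (fun v g => 'D_v g) f vs.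

Definition smooth (V : normedModType R) (f : V -> R) : Prop :=
  forall vs : seq V, continuous (iter_derive f vs) /\
    forall x v, derivable (iter_derive f vs) x v.

Definition test_function (V : normedModType R) (D : set V) (psi : V -> R) : Prop :=
  smooth psi /\
  exists K : set V, [/\ compact K, K `<=` D & forall x, ~ K x -> psi x = 0].

Notation leb := (@lebesgue_measure R).
Notation leb2 := (leb \x leb)%E.
Notation leb3 := (leb2 \x leb)%E.

Definition prob01 (nu : probability (measurableTypeR R) R) : Prop :=
  nu `[0, 1]%classic = 1%E.

Definition cdf01 (nu : probability (measurableTypeR R) R) (t : R) : R :=
  fine (nu `[0, t]%classic).

(* Points of space-time [0,1] x R are pairs (t, x). *)
Definition strip1 : set (R * R) := `]0, 1[%classic `*` setT.
Definition cstrip1 : set (R * R) := `[0, 1]%classic `*` setT.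
Definition dt1 : R * R := (1, 0).
Definition dx1 : R * R := (0, 1).

(* du is the weak derivative of u in x. *)
Definition parisi_pde1 (beta : R^nat) (m : R -> R) (u : R * R -> R) : Prop :=
  [/\ {within cstrip1, continuous u},
      forall x, u (1, x) = ln ((expR x + expR (- x)) / 2) &
      exists du : R * R -> R,
      [/\ measurable_fun (strip1 : set (measurableTypeR R * measurableTypeR R)) du,
          exists M : R, {ae leb2, forall z, strip1 z -> `|du z| <= M},
          forall psi, test_function strip1 psi ->
            \int[leb2]_(z in strip1) (u z * 'D_dx1 psi z) =
            - \int[leb2]_(z in strip1) (du z * psi z) &
          forall psi, test_function strip1 psi ->
            \int[leb2]_(z in strip1)
              (- (u z * 'D_dt1 psi z)
               + xi2 beta z.1 / 2 *
                   (u z * 'D_dx1 ('D_dx1 psi) z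
                    + m z.1 * du z ^+ 2 * psi z)) = 0]].

Definition parisi_sol1 (beta : R^nat) (m : R -> R) : R * R -> R :=
  get [set u | parisi_pde1 beta m u].

Definition parisi_I (beta : R^nat) (h : R)
    (nu : probability (measurableTypeR R) R) : R :=
  parisi_sol1 beta (cdf01 nu) (0, h)
  - 2^-1 * \int[leb]_(s in `[0, 1]) (xi2 beta s * s * cdf01 nu s).

(* Points of space-time [0,1] x R^2 are (t, x1, x2). *)
Definition strip2 : set (R * R * R) := strip1 `*` setT.
Definition cstrip2 : set (R * R * R) := cstrip1 `*` setT.
Definition dt2 : R * R * R := (1, 0, 0).
Definition dx2 (i : 'I_2) : R * R * R :=
  if i == ord0 then (0, 1, 0) else (0, 0, 1).

Definition parisi_pde2 (A : R -> 'M[R]_2) (m : R -> R) (g : R * R -> R)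
    (u : R * R * R -> R) : Prop :=
  [/\ {within cstrip2, continuous u},
      forall x1 x2, u (1, x1, x2) = g (x1, x2) &
      exists du : 'I_2 -> R * R * R -> R,
      [/\ forall i, measurable_fun (strip2 : set (measurableTypeR R *
            measurableTypeR R * measurableTypeR R)) (du i),
          forall i, exists M : R,
            {ae leb3, forall z, strip2 z -> `|du i z| <= M},
          forall i psi, test_function strip2 psi ->
            \int[leb3]_(z in strip2) (u z * 'D_(dx2 i) psi z) =
            - \int[leb3]_(z in strip2) (du i z * psi z) &
          forall psi, test_function strip2 psi ->
            \int[leb3]_(z in strip2)
              (- (u z * 'D_dt2 psi z)
               + 2^-1 * \sum_(i < 2) \sum_(j < 2) A z.1.1 i j *
                   (u z * 'D_(dx2 i) ('D_(dx2 j) psi) z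
                    + m z.1.1 * du i z * du j z * psi z)) = 0]].

Definition psd (M : 'M[R]_2) : Prop :=
  M^T = M /\ forall x : 'rV[R]_2, 0 <= (x *m M *m x^T) 0 0.

Definition uniformly_elliptic (A : R -> 'M[R]_2) : Prop :=
  exists2 c : R, 0 < c & {ae leb, forall t, 0 <= t <= 1 -> psd (A t - c%:M)}.

(* Off the uniformly elliptic case, u is the limit, as e decreases to 0, of the
   solutions for A + e Id. *)
Definition parisi_sol2 (A : R -> 'M[R]_2) (m : R -> R) (g : R * R -> R)
    (z : R * R * R) : R :=
  if `[< uniformly_elliptic A >] then (get [set u | parisi_pde2 A m g u]) z
  else lim ((get [set u | parisi_pde2 (fun t => A t + e%:M) m g u]) z
            @[e --> 0^'+]).

(* A path in Q_q is given together with its weak derivative dQ, which is unique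
   up to null sets. *)
Definition admissible_path (q : R) (Q dQ : R -> 'M[R]_2) : Prop :=
  [/\ forall i j, {within `[0, 1], continuous (fun t => Q t i j)},
      forall i j, leb.-integrable `[0, 1] (EFin \o (fun t => dQ t i j)) /\
        forall psi : R -> R, @test_function R^o `]0, 1[%classic psi ->
          \int[leb]_(t in `]0, 1[) (Q t i j * derive1 psi t) =
          - \int[leb]_(t in `]0, 1[) (dQ t i j * psi t),
      forall t, 0 <= t <= 1 -> psd (Q t),
      forall s t, 0 <= s -> s <= t -> t <= 1 -> psd (Q t - Q s) &
      Q 0 = 0 /\ Q 1 = \matrix_(i < 2, j < 2) (if i == j then 1 else q)].

Definition diffusion (beta : R^nat) (Q dQ : R -> 'M[R]_2) (t : R) : 'M[R]_2 :=
  \matrix_(i < 2, j < 2) (xi2 beta (Q t i j) * dQ t i j).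

Definition sign (b : bool) : R := (-1) ^+ b.

Definition terminal2 (lambda : R) (x : R * R) : R :=
  ln (4^-1 * \sum_(e1 : bool) \sum_(e2 : bool)
    expR (sign e1 * x.1 + sign e2 * x.2 + lambda * sign e1 * sign e2)).

Definition parisi_P (beta : R^nat) (h q : R)
    (nu : probability (measurableTypeR R) R) (Q dQ : R -> 'M[R]_2)
    (lambda : R) : R :=
  parisi_sol2 (diffusion beta Q dQ) (cdf01 nu) (terminal2 lambda) (0, h, h)
  - lambda * q
  - 2^-1 * \sum_(i < 2) \sum_(j < 2) \int[leb]_(t in `[0, 1])
      (cdf01 nu t * xi2 beta (Q t i j) * Q t i j * dQ t i j).

Local Open Scope ereal_scope.

Definition overlap_rate (beta : R^nat) (h q : R) : \bar R :=
  - ereal_inf [set y | exists lambda Q dQ nu,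
      [/\ admissible_path q Q dQ, prob01 nu &
          y = (parisi_P beta h q nu Q dQ lambda)%:E]]
  + 2%:E * ereal_inf [set y | exists2 nu, prob01 nu &
      y = (parisi_I beta h nu)%:E].

End WeakSolutions.

(* Main.v *)
(* Almost surely, by Borel-Cantelli, the overlap law of the middle interval is
   eventually at most exp(-CN), so the lower bound of the LDP on that open
   interval gives I(q2) >= C.  If I were bounded below by some a > 0 on the closed
   interval around q1 or q3, the upper bound of the LDP would make the overlap
   law of that interval vanish almost surely, hence in mean.  So both intervals
   contain points where I is below C/4, and these, together with q2, form a
   triple with positive barrier. *)

Require Import Defs.
From HB Require Import structures.
From mathcomp Require Import all_boot all_order all_algebra.
From mathcomp Require Import all_classical all_reals all_analysis.
From mathcomp Require Import measurable_realfun lra.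

Import Order.TTheory GRing.Theory Num.Theory.
Import numFieldNormedType.Exports.

Local Open Scope classical_set_scope.
Local Open Scope ring_scope.

(** * Exponential decay rates of sequences and the Borel-Cantelli lemma *)

Lemma limn_esup_lt_near (R : realType) (u : (\bar R)^nat) (a : \bar R) :
  (limn_esup u < a)%E -> \forall n \near \oo, (u n < a)%E.
Proof.
rewrite /limn_esup limf_esupE => /ereal_inf_lt[_ [V Voo <-] Va].
apply: filterS Voo => n Vn; apply: le_lt_trans Va.
by apply: ereal_sup_ubound; exists n.
Qed.

Lemma limn_esup_le_near (R : realType) (u : (\bar R)^nat) (a : \bar R) :
  (\forall n \near \oo, (u n <= a)%E) -> (limn_esup u <= a)%E.
Proof.
move=> ua; rewrite /limn_esup limf_esupE.
apply: ereal_inf_le; exists (ereal_sup (u @` [set n | (u n <= a)%E])).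
  by exists [set n | (u n <= a)%E].
by apply: ge_ereal_sup => _ [n ? <-].
Qed.

(** Any [c] with the upper limit below [- c] serves: the bound then holds eventually, and
    multiplying by [n] and exponentiating gives the decay. *)
Lemma near_le_expR_limn_esup (R : realType) (u : (\bar R)^nat) :
  (limn_esup (fun n => n%:R^-1%:E * lne (u n)) < 0)%E ->
  exists2 c : R, 0 < c & \forall n \near \oo, (u n <= (expR (- (c * n%:R)))%:E)%E.
Proof.
move=> lt0.
have [c c0 ltc] : exists2 c : R, 0 < c &
    (limn_esup (fun n => n%:R^-1%:E * lne (u n)) < (- c)%:E)%E.
  move: lt0; case: limn_esup => [r| |]//; rewrite ?lte_fin => r0.
    by exists (- r / 2); rewrite ?lte_fin; lra.
  (* If the upper limit is [-oo], every positive rate works. *)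
  by exists 1 => //; rewrite ltNyr.
exists c => //; near=> n.
have n0 : 0 < n%:R :> R by rewrite ltr0n; near: n; exists 1%N.
have : (n%:R^-1%:E * lne (u n) < (- c)%:E)%E.
  by near: n; exact: limn_esup_lt_near.
case: (u n) => [r| |] /=; [|by rewrite gt0_muley// lte_fin invr_gt0|by rewrite leNye].
have [r0|r0] := leP r 0; first by rewrite lee_fin (le_trans r0)// expR_ge0.
rewrite -EFinM lte_fin ltr_pdivrMl// => lnr.
rewrite lee_fin -[leLHS]lnK ?posrE// ler_expR; nra.
Unshelve. all: by end_near. Qed.

Lemma expR_mulrn_cvg0 (R : realType) (c : R) : 0 < c ->
  expR (- (c * n%:R)) @[n --> \oo] --> 0.
Proof.
move=> c0; have -> : (fun n => expR (- (c * n%:R))) = geometric 1 (expR (- c)).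
  by apply/funext => n /=; rewrite mul1r -mulNr expRM_natr.
by apply: cvg_geometric; rewrite ger0_norm ?expR_ge0// expR_lt1 oppr_lt0.
Qed.

Lemma near_le_expR_limn_einf (R : realType) (u : (\bar R)^nat) (C : R) :
  (\forall n \near \oo, (u n <= (expR (- (C * n%:R)))%:E)%E) ->
  (limn_einf (fun n => n%:R^-1%:E * lne (u n)) <= (- C)%:E)%E.
Proof.
move=> uC; apply: le_trans (limn_einf_sup _) _; apply: limn_esup_le_near.
near=> n.
have n0 : 0 < n%:R :> R by rewrite ltr0n; near: n; exists 1%N.
have : (u n <= (expR (- (C * n%:R)))%:E)%E by near: n.
rewrite lee_pdivrMl//.
case: (u n) => [r| |] //=; last by rewrite !leNye.
have [r0|r0] := leP r 0; first by rewrite leNye.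
by rewrite -EFinM !lee_fin -ler_ln ?posrE ?expR_gt0// expRK mulrN mulrC.
Unshelve. all: by end_near. Qed.

Lemma borel_cantelli_expR (R : realType) (d : measure_display)
    (T : measurableType d) (P : probability T R) (F : (set T)^nat) (c : R) :
  0 < c -> (forall n, measurable (F n)) ->
  (\forall n \near \oo, (P (F n) <= (expR (- (c * n%:R)))%:E)%E) ->
  {ae P, forall w, \forall n \near \oo, ~ F n w}.
Proof.
move=> c0 mF [n0 _ PF].
have : P (lim_sup_set (fun k => F (n0 + k)%N)) = 0%E.
  (* The bound on [P (F n)] is known only from [n0] on, hence the shift; as [n0 + k] is at least
     [k], a geometric series of ratio [expR (- c)] dominates the probabilities. *)
  apply: lim_sup_set_cvg0 => //.
  have ec_lt1 : expR (- c) < 1 by rewrite expR_lt1 oppr_lt0.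
  apply: (@le_lt_trans _ _ (1 / (1 - expR (- c)))%:E); last exact: ltry.
  apply: lime_le; first exact: is_cvg_nneseries.
  near=> n; apply: le_trans (_ : (series (geometric 1 (expR (- c))) n)%:E <= _)%E.
    rewrite /series/= -sumEFin; apply: lee_sum => k _.
    apply: le_trans (PF (n0 + k)%N (leq_addr _ _)) _.
    rewrite lee_fin mul1r -expRM_natr ler_expR mulNr lerN2.
    by rewrite ler_pM2l// ler_nat leq_addl.
  by rewrite lee_fin geometric_le_lim ?expR_gt0// ger0_norm ?expR_ge0.
move=> P0; exists (lim_sup_set (fun k => F (n0 + k)%N)); split => //.
  by apply: bigcapT_measurable => n; apply: bigcup_measurable.
(* By contraposition: if [F k w] recurs for arbitrarily large [k], some [k] beyond [n0 + n] yields
   the shifted index [k - n0], which is at least [n]. *)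
move=> w /= nw n _; apply: contrapT => nFw; apply: nw.
exists (n0 + n)%N => // k /= nk Fk; apply: nFw; exists (k - n0)%N => /=.
  by rewrite leq_subRL// (leq_trans (leq_addr _ _) nk).
by rewrite subnKC// (leq_trans (leq_addr _ _) nk).
Unshelve. all: by end_near. Qed.

(** * The overlap law for a fixed energy function *)

Section OverlapLaw.
Context {R : realType} {N : nat} (E : config N -> R).

Lemma partition_function_gt0 : 0 < partition_function E.
Proof.
rewrite /partition_function (bigD1 [ffun=> true])//= ltr_pwDl//.
  by rewrite mulr_gt0 ?expR_gt0// invr_gt0 exprn_gt0.
by apply: sumr_ge0 => s _; rewrite mulr_ge0 ?expR_ge0// invr_ge0 exprn_ge0.
Qed.

Lemma gibbs_ge0 (s : config N) : 0 <= gibbs E s.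
Proof.
by rewrite divr_ge0 ?(ltW partition_function_gt0)// mulr_ge0 ?expR_ge0.
Qed.

Lemma sum_gibbs : \sum_(s : config N) gibbs E s = 1.
Proof.
by rewrite -mulr_suml divff// gt_eqF// partition_function_gt0.
Qed.

Lemma overlap_law_ge0 (A : set R) : 0 <= overlap_law E A.
Proof.
apply: sumr_ge0 => s _; apply: sumr_ge0 => t _.
by rewrite mulr_ge0// mulr_ge0 ?gibbs_ge0.
Qed.

Lemma le_overlap_law (A B : set R) :
  A `<=` B -> overlap_law E A <= overlap_law E B.
Proof.
move=> AB; apply: ler_sum => s _; apply: ler_sum => t _.
apply: ler_wpM2l; first by rewrite mulr_ge0 ?gibbs_ge0.
rewrite !indicE ler_nat.
have [/set_mem/AB ABst|//] := boolP (_ \in A).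
by rewrite mem_set.
Qed.

Lemma overlap_law_le1 (A : set R) : overlap_law E A <= 1.
Proof.
apply: le_trans (le_overlap_law A setT (@subsetT _ _)) _.
rewrite /overlap_law; under eq_bigr => s _.
  under eq_bigr do rewrite indicT mulr1.
  rewrite -mulr_sumr sum_gibbs mulr1; over.
by rewrite sum_gibbs.
Qed.

End OverlapLaw.

(** * The overlap law as a random variable, and the choice of sample points *)

Lemma measurable_random_overlap_law (R : realType) (d : measure_display)
    (T : measurableType d) (P : probability T R)
    (H : forall N, config N -> {RV P >-> R}) (N : nat) (A : set R) :
  measurable_fun setT (fun w => random_overlap_law H w N A).
Proof.
have mE (s : config N) : measurable_fun setT (fun w => expR (- H N s w)).
  apply: measurableT_comp; first exact: measurable_expR.
  exact: measurable_funN.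
have mZ : measurable_fun setT (fun w => partition_function (fun s => H N s w)).
  by apply: measurable_sum => s; apply: measurable_funM.
have mG (s : config N) : measurable_fun setT (fun w => gibbs (fun s => H N s w) s).
  (* Writing the inverse of the positive partition function as [expR (- ln _)] reduces division to
     compositions of measurable functions. *)
  have -> : (fun w => gibbs (fun s => H N s w) s) = (fun w =>
      (2 ^+ N)^-1 * expR (- H N s w) *
        expR (- ln (partition_function (fun s => H N s w)))).
    apply/funext => w.
    by rewrite [expR (- ln _)]expRN lnK// posrE partition_function_gt0.
  apply: measurable_funM; first exact: measurable_funM.
  apply: measurableT_comp; first exact: measurable_expR.
  by apply: measurable_funN; exact: measurableT_comp (@measurable_ln R) mZ.
apply: measurable_sum => s; apply: measurable_sum => t.
by do !apply: measurable_funM => //.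
Qed.

(** Total mass 1 makes the almost-everywhere filter proper. Since the rate function is
    deterministic, one good sample point suffices to derive facts about it. *)
Lemma ae_probability_ex (R : realType) (d : measure_display)
    (T : measurableType d) (P : probability T R) (A : T -> Prop) :
  {ae P, forall w, A w} -> exists w, A w.
Proof.
have P0 : (0 < P [set: T])%E by rewrite probability_setT.
by move=> /(@filter_ex _ _ (ae_properfilter_algebraOfSetsType P0)).
Qed.

(** * Pointwise bounds on the rate function *)

Section RateFunction.
Context {R : realType} (d : measure_display) (T : measurableType d)
  (P : probability T R) (H : forall N, config N -> {RV P >-> R})
  (I : R -> \bar R).

Lemma rate_ge0
    (hLDP : {ae P, forall w,
       large_deviation_principle (random_overlap_law H w) I})
    (q : R) : -1 <= q <= 1 -> (0 <= I q)%E.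
Proof.
by have [w [I0 _ _ _]] := ae_probability_ex _ _ _ _ _ hLDP; exact: I0.
Qed.

Lemma overlap_gap_rate_ge
    (hLDP : {ae P, forall w,
       large_deviation_principle (random_overlap_law H w) I})
    (C q e : R) : 0 < e -> -1 <= q <= 1 ->
  (limn_esup (fun N => N%:R^-1%:E * lne (P [set w |
     expR (- (C * N%:R)) < random_overlap_law H w N (near_itv q e)]%R))
     < 0)%E ->
  (C%:E <= I q)%E.
Proof.
move=> e0 q11 /near_le_expR_limn_esup[c c0 Pc].
have mF N : measurable [set w |
    expR (- (C * N%:R)) < random_overlap_law H w N (near_itv q e)].
  rewrite -[X in measurable X]setTI.
  have := measurable_random_overlap_law _ _ _ P H N (near_itv q e) measurableT
    `]expR (- (C * N%:R)), +oo[%classic (measurable_itv _).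
  congr (measurable (_ `&` _)).
  by apply/seteqP; split => w /=; rewrite in_itv/= andbT.
have QC := borel_cantelli_expR _ _ _ P _ _ c0 mF Pc.
(* Fix one sample point at which both the large deviation principle and the Borel-Cantelli
   conclusion hold. *)
have [w [[_ _ _ lower] {}QC]] := ae_probability_ex _ _ _ _ _ (filterI hLDP QC).
have Q_le := lower (near_itv q e) (itv_open _ _).
have Q_small : \forall N \near \oo,
    ((random_overlap_law H w N (near_itv q e))%:E <= (expR (- (C * N%:R)))%:E)%E.
  by apply: filterS QC => N /negP; rewrite -leNgt lee_fin.
rewrite -leeN2 -EFinN; apply: le_trans _ (near_le_expR_limn_einf _ _ _ Q_small).
apply: le_trans Q_le; rewrite leeN2.
apply: ereal_inf_lbound; exists q => //; split.
  by rewrite /near_itv /= in_itv/=; lra.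
by rewrite /= in_itv.
Qed.

Lemma charged_itv_rate_lt
    (hLDP : {ae P, forall w,
       large_deviation_principle (random_overlap_law H w) I})
    (q e a : R) : 0 < a ->
  (0 < limn_einf (fun N =>
     'E_P[fun w => random_overlap_law H w N (near_itv q e)]))%E ->
  exists r : R, [/\ q - e <= r <= q + e, -1 <= r <= 1 & (I r < a%:E)%E].
Proof.
move=> a0 E_gt0; apply: contrapT => no_r.
(* The upper bound of the large deviation principle needs a closed set, so the open interval is
   enlarged to its closure; this is why [r] may be an endpoint. *)
have a_inf : (a%:E <=
    ereal_inf (I @` (`[q - e, q + e] `&` `[-1, 1])%R))%E.
  apply/ereal_infP => _ [r [/= qr r1] <-]; rewrite leNgt; apply/negP => Ira.
  by apply: no_r; exists r; rewrite !in_itv/= in qr r1.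
have Q0 : {ae P, forall w, setT w ->
    (random_overlap_law H w N (near_itv q e))%:E @[N --> \oo] --> (0 : \bar R)%E}.
  apply: filterS hLDP => w [_ _ upper _] _.
  have := upper `[q - e, q + e]%classic (@itv_closed _ _ _ _).
  move=> /le_lt_trans-/(_ 0%E).
  rewrite oppe_lt0 (lt_le_trans _ a_inf) ?lte_fin// => /(_ isT).
  move=> /near_le_expR_limn_esup[c c0 Qc].
  apply: (@squeeze_cvge _ _ _ _ (cst 0%E) _
    (fun N => (expR (- (c * N%:R)))%:E)).
  - apply: filterS Qc => N QN; rewrite lee_fin overlap_law_ge0/=.
    apply: le_trans QN; rewrite lee_fin; apply: le_overlap_law.
    by apply: subset_itv; rewrite bnd_simp.
  - exact: cvg_cst.
  - by apply: cvg_EFin; [exact: nearW|exact: expR_mulrn_cvg0].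
have mQ N : measurable_fun setT
    (fun w => (random_overlap_law H w N (near_itv q e))%:E).
  exact/measurable_EFinP/measurable_random_overlap_law.
have Q1 : {ae P, forall w N, setT w ->
    (`|(random_overlap_law H w N (near_itv q e))%:E| <= cst 1 w)%E}.
  apply: aeW => w N _.
  by rewrite gee0_abs ?lee_fin ?overlap_law_ge0// overlap_law_le1.
have int1 : P.-integrable setT (cst 1%E : T -> \bar R).
  exact: finite_measure_integrable_cst.
(* Masses are at most 1, so almost sure convergence to 0 passes to the means, against their positive
   lower limit. *)
have [_ _] := dominated_convergence measurableT mQ (measurable_cst 0%E) Q0 int1 Q1.
rewrite integral0 => /cvg_limn_einf_sup[Einf _].
by move: E_gt0; rewrite unlock Einf ltxx.
Qed.

End RateFunction.

Theorem proposition1p15 (R : realType) (beta : R^nat) (h : R)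
  (hxi : exists2 e : R, 0 < e & cvgn (xi_psum beta (1 + e)))
  (hconvex : convex_function (`[-1, 1]%classic : set R) (xi beta))
  (hh : 0 <= h)
  (d : measure_display) (T : measurableType d) (P : probability T R)
  (H : forall N, config N -> {RV P >-> R})
  (hH : ising_mixed_p_spin beta h H)
  (I : R -> \bar R)
  (hI : forall q : R, -1 <= q <= 1 -> I q = overlap_rate beta h q)
  (hLDP : {ae P, forall w, large_deviation_principle (random_overlap_law H w) I}) :
  FEB H -> generalized_FEB I.
Proof.
move=> [C [q1 [q2 [q3 [e [C0 [q1_ge q12 q23 q3_le] /andP[e0 e_lt] gap charged]]]]]].
(* This keeps the closed [e]-neighbourhoods of [q1] and [q3] strictly on either side of [q2], so
   that [r1 < q2 < r3] below. *)
have [e21 e32] : e < q2 - q1 /\ e < q3 - q2.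
  by move: e_lt; rewrite -ltr_pdivrMl// lt_min => /andP[]; split; lra.
have Iq2 : (C%:E <= I q2)%E.
  by apply: overlap_gap_rate_ge hLDP _ _ _ e0 _ gap; lra.
(* With both outer rates below [C / 4], the alternating sum exceeds [C - C / 4 - C / 4], which is
   [C / 2]. *)
have C4 : 0 < C / 4 by lra.
have [r1 [r1q r1I Ir1]] := charged_itv_rate_lt _ _ _ _ _ hLDP _ _ _ C4
  (charged q1 (or_introl erefl)).
have [r3 [r3q r3I Ir3]] := charged_itv_rate_lt _ _ _ _ _ hLDP _ _ _ C4
  (charged q3 (or_intror erefl)).
have Ir1_ge0 := rate_ge0 _ _ _ _ _ hLDP r1 r1I.
have Ir3_ge0 := rate_ge0 _ _ _ _ _ hLDP r3 r3I.
apply: lt_le_trans (_ : - I r1 + I q2 - I r3 <= _)%E; last first.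
  by apply: ereal_sup_ubound; exists r1, q2, r3; split => //; lra.
move: Ir1 Ir3 Iq2 Ir1_ge0 Ir3_ge0.
(* The outer rates are finite, being nonnegative and below [C / 4]; only [I q2] may be [+oo], and
   then the alternating sum is [+oo] as well. *)
case: (I r1) => [x1| |]//; case: (I r3) => [x3| |]//; case: (I q2) => [x2| |]//.
  by rewrite -!EFinN -!EFinD !lee_fin !lte_fin; lra.
by move=> *; exact: ltry.
Qed.
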